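(* Let $G$ be a cubic planar graph. If $G$ is cyclically $4$-edge connected, then $G$ has a strong embedding on an orientable surface of positive genus.
   Context: All graphs are undirected, connected, simple and finite. A graph $G$ is cyclically $k$-edge connected if there is no set $A\subseteq E(G)$ of at most $k-1$ edges such that the graph $G\setminus A$ (delete the edges of $A$) has at least two connected components containing a cycle. A surface is a compact $2$-dimensional manifold without boundary. An embedding of $G$ on a surface $S$ is an injective continuous map $\beta:G\to S$; all embeddings are cellular, i.e. every connected component of $S\setminus\beta(G)$ (a cell) is homeomorphic to an open $2$-cell. A facial walk is a closed walk of the embedded graph that bounds a cell. A cycle is a closed walk in which only the start and end vertices are the same. An embedding is strong if every facial walk is a cycle of $G$.
   Formalization: The complete graph K4 is excluded: it is cubic, planar and vacuously cyclically 4-edge connected, yet has no strong embedding on an orientable surface of positive genus, since at most two facial cycles of length at most 4 cannot cover its six edges twice. *)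

(* Defs.v *)
From mathcomp Require Import all_boot all_order all_algebra fingroup perm.
From mathcomp Require Import zify.

Set Implicit Arguments.
Unset Strict Implicit.
Unset Printing Implicit Defensive.

Import GRing.Theory.

Record sgraph := SGraph {
  vertex :> finType;
  adj : rel vertex;
  adj_sym : symmetric adj;
  adj_irrefl : irreflexive adj }.

Definition edges (G : sgraph) : {set {set G}} :=
  [set [set p.1; p.2] | p : G * G & adj p.1 p.2].

Definition connected (G : sgraph) : Prop :=
  0 < #|G| /\ forall x y : G, connect (@adj G) x y.

Definition cubic (G : sgraph) : Prop :=
  forall x : G, #|[set y | adj x y]| = 3.

(* [c] lists the vertices of the cycle once each; the closing step from the
   last one to the first one is checked by [path.cycle].  The size condition
   excludes going back and forth along a single edge. *)
Definition is_cycle (T : eqType) (e : rel T) (c : seq T) : bool :=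
  [&& 2 < size c, path.cycle e c & uniq c].

Definition delete_edges (G : sgraph) (A : {set {set G}}) : rel G :=
  [rel x y | adj x y && ([set x; y] \notin A)].

Definition component_has_cycle (T : finType) (e : rel T) (x : T) : Prop :=
  exists c : seq T, is_cycle e c /\ {subset c <= connect e x}.

Definition cyclically_edge_connected (k : nat) (G : sgraph) : Prop :=
  forall A : {set {set G}}, A \subset edges G -> #|A| < k ->
  ~ exists x y : G,
      [/\ ~~ connect (delete_edges A) x y,
          component_has_cycle (delete_edges A) x &
          component_has_cycle (delete_edges A) y].

(* Cellular embeddings of a connected graph (with at least one edge) in
   oriented surfaces are described by rotation systems: the darts are the
   edges with a direction, and the rotation sends each dart to the next one
   with the same tail, in the cyclic order around that tail given by the
   orientation of the surface. *)
Notation dart G := {d : vertex G * vertex G | adj d.1 d.2}.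

Definition tail (G : sgraph) (d : dart G) : G := (val d).1.
Definition head (G : sgraph) (d : dart G) : G := (val d).2.

Record rotation_system (G : sgraph) := RotationSystem {
  rot :> {perm dart G};
  rotP : forall d d' : dart G, (d' \in porbit rot d) = (tail d' == tail d) }.

Lemma dart_rev_subproof (G : sgraph) (d : dart G) : adj (head d) (tail d).
Proof. by rewrite adj_sym; exact: (valP d). Qed.

Definition dart_rev_fun (G : sgraph) (d : dart G) : dart G :=
  exist (fun p : G * G => adj p.1 p.2) (head d, tail d) (dart_rev_subproof d).

Lemma dart_rev_inj (G : sgraph) : injective (@dart_rev_fun G).
Proof.
apply: (can_inj (g := @dart_rev_fun G)) => d; apply: val_inj => /=.
by rewrite /tail /head /=; case: d => -[].
Qed.

Definition dart_rev (G : sgraph) : {perm dart G} := perm (@dart_rev_inj G).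

(* Face tracing: traverse a dart, then leave its head along the dart that the
   rotation puts after the reversed one.  The cells are the orbits. *)
Definition face_perm (G : sgraph) (R : rotation_system G) : {perm dart G} :=
  (dart_rev G * R)%g.

Definition faces (G : sgraph) (R : rotation_system G) : {set {set dart G}} :=
  porbits (face_perm R).

(* The facial walk through [d], as the list of the tails of its darts. *)
Definition facial_walk (G : sgraph) (R : rotation_system G) (d : dart G) :
    seq G :=
  [seq tail x | x <- traject (face_perm R) d #|porbit (face_perm R) d|].

Definition strong (G : sgraph) (R : rotation_system G) : Prop :=
  forall d : dart G, is_cycle (@adj G) (facial_walk R d).

Definition euler_char (G : sgraph) (R : rotation_system G) : int :=
  (#|G|%:Z - #|edges G|%:Z + #|faces R|%:Z)%R.

(* A closed connected orientable surface is determined by its Euler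
   characteristic, which is 2 - 2g for genus g. *)
Definition embeds_in_genus (G : sgraph) (R : rotation_system G) (g : nat) :
    Prop :=
  euler_char R = (2 - 2 * g%:Z)%R.

Definition planar (G : sgraph) : Prop :=
  exists R : rotation_system G, embeds_in_genus R 0.

Definition complete (G : sgraph) : Prop :=
  forall x y : G, x != y -> adj x y.

(* The complete cubic graph is K4.  It is planar, and it is cyclically k-edge
   connected for every k since it has no two disjoint cycles, but its only
   strong embeddings in orientable surfaces are those in the sphere. *)
Lemma K4_exception (G : sgraph) (R : rotation_system G) (g : nat) :
  connected G -> cubic G -> complete G -> strong R -> embeds_in_genus R g ->
  g = 0.
Proof.
move=> [/card_gt0P[x0 _] _] cG kG sR; rewrite /embeds_in_genus /euler_char.
have nb (x : G) : [set y | adj x y] = [set~ x].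
  apply/setP=> y; rewrite !inE; case: (eqVneq y x) => [->|]; first by rewrite adj_irrefl.
  by rewrite eq_sym => nxy; rewrite kG.
have n4 : #|G| = 4 by have := cG x0; rewrite nb cardsC1; lia.
have cE : #|edges G| <= 6.
  have /subset_leq_card : edges G \subset [set A : {set G} | #|A| == 2].
    apply/subsetP=> _ /imsetP[[x y] /= axy ->]; rewrite inE cards2.
    by have -> : x != y by apply: contraTneq axy => ->; rewrite inE /= adj_irrefl.
  by rewrite card_draws n4.
have cD : #|{: dart G}| = 12.
  rewrite card_sig -sum1_card.
  rewrite -(pair_big_dep predT (fun x y => adj x y) (fun _ _ => 1)) /=.
  under eq_bigr => x _ do rewrite sum1dep_card cG.
  by rewrite sum_nat_const n4.
have F3 : 3 <= #|faces R|.
  have E12 : 12 <= \sum_(c in faces R) #|c|.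
    rewrite -cD -cardsT; apply: leq_trans (leq_card_cover (faces R)).
    apply/subset_leq_card/subsetP=> d _; apply/bigcupP.
    by exists (porbit (face_perm R) d); rewrite ?porbit_id ?imset_f.
  suff : 12 <= #|faces R| * 4 by lia.
  apply: leq_trans E12 _.
  rewrite -sum_nat_const; apply: leq_sum => _ /imsetP[d _ ->].
  have /and3P[_ _ /card_uniqP] := sR d.
  rewrite size_map size_traject => <-; rewrite -n4; exact: max_card.
by lia.
Qed.

(* Main.v *)
Require Import Defs.
From mathcomp Require Import all_boot all_order all_algebra fingroup perm.
From mathcomp Require Import zify.

(** A planar embedding of [G] is fixed, and its dual graph is considered: its
    vertices are the faces of [G], and it is a triangulation because [G] is
    cubic.  Cyclic 4-edge connectivity says that this triangulation is
    4-connected: faces are adjacent along at most one edge, three mutually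
    adjacent faces meet at a vertex, so the link of every face is an induced
    cycle, and it has length at least 4 unless [G] is complete.

    The dual graph contains a cycle [c] of even length that has no chord between
    vertices of the same parity ([even_hole]): the link of a face of even length,
    or a square without diagonals, or the ring of faces around an edge whose two
    faces have odd length.

    The edges of [G] crossed by [c] form the cut of a set [X] of vertices; this
    instance of the Jordan curve theorem follows from a count of dimensions modulo
    2 in Euler's formula ([even_cut]).  Inverting the rotation at the vertices of
    [X] gives the new embedding ([twist]).  Faces off [c] do not change.  The cut
    divides the boundary of each face on [c] into an inner and an outer part, and
    the new faces alternate between the outer parts of faces of one parity and the
    inner parts of faces of the other parity.  Faces of the same parity are not
    adjacent, so in the cubic graph [G] their boundaries are disjoint, and the new
    faces are cycles ([twist_strong]).

    The new embedding is not planar, because the two new faces along the inner and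
    the outer part of an old face on [c] share two edges, whereas the properties
    above hold for every planar embedding ([twist_nonplanar]).  Its Euler
    characteristic is even and at most 2, so its genus is positive
    ([positive_genus]). *)

Set Implicit Arguments.
Unset Strict Implicit.
Unset Printing Implicit Defensive.

Import GRing.Theory.

(** * Even cycles without monochromatic chords *)

Section EvenHole.

Variables (F : eqType) (e : rel F).
Hypotheses (es : symmetric e) (ei : irreflexive e).

Definition proper_on (k : F -> bool) (s : seq F) : Prop :=
  {in s &, forall a b, e a b -> k a != k b}.

(** A proper colouring alternates along the cycle, so the length is even and the
    chords join positions of opposite parity.  This is weaker than being induced,
    and it is what the twisting of a rotation system needs. *)
Definition bipartite_cycle (c : seq F) (k : F -> bool) : Prop :=
  is_cycle e c /\ proper_on k c.

Lemma proper_on_last k x p : path e x p -> proper_on k (x :: p) ->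
  k (last x p) = k x (+) odd (size p).
Proof.
elim: p x => [|y p IHp] x /=; first by rewrite addbF.
case/andP=> xy py kp; rewrite IHp //.
  have := kp x y (mem_head _ _) _ xy; rewrite !inE eqxx orbT => /(_ isT).
  by case: (k x) (k y) (odd _) => [] [] [].
by move=> a b ap bp; apply: kp; rewrite in_cons (ap, bp) orbT.
Qed.

(** This is the form that 4-connectedness of a triangulation takes below: the link
    of a vertex is an induced cycle. *)
Definition chordless (l : seq F) : Prop :=
  {in l &, forall a b, e a b -> b = next l a \/ a = next l b}.

(** The length matters at the closing step only, which leads from the last
    position, an odd one, to position 0. *)
Lemma index_next (l : seq F) x : uniq l -> x \in l -> ~~ odd (size l) ->
  odd (index (next l x) l) = ~~ odd (index x l).
Proof.
case: l => // y l ul xl sl; rewrite next_nth xl.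
have [lt|ge] := ltnP (index x (y :: l)) (size l).
  by rewrite -[nth y l _]/(nth y (y :: l) (index x (y :: l)).+1) index_uniq.
have -> : index x (y :: l) = size l.
  apply/eqP; rewrite eqn_leq ge andbT -ltnS.
  by rewrite -[(size l).+1]/(size (y :: l)) index_mem.
by move: sl; rewrite nth_default //= eqxx negbK => ->.
Qed.

Lemma proper_on_chordless (l : seq F) : uniq l -> chordless l -> ~~ odd (size l) ->
  proper_on (fun x => odd (index x l)) l.
Proof.
move=> ul cl sl a b al bl /(cl _ _ al bl)[] ->; rewrite index_next //.
  by case: (odd _).
by case: (odd _).
Qed.

Lemma next_cons_index (g : F) s x : uniq (g :: s) -> x \in s ->
  next (g :: s) x = nth g s (index x s).+1.
Proof.
move=> u xs; case/andP: (u : (g \notin s) && uniq s) => gs us.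
rewrite next_nth inE xs orbT /=.
by case: eqP => // e0; rewrite e0 xs in gs.
Qed.

Lemma proper_on_chordless_behead (g : F) s : uniq (g :: s) -> chordless (g :: s) ->
  proper_on (fun x => odd (index x s)) s.
Proof.
move=> u cl; case/andP: (u : (g \notin s) && uniq s) => gs us.
have flip x y : x \in s -> y \in s -> y = next (g :: s) x ->
    odd (index x s) != odd (index y s).
  move=> xs ys; rewrite next_cons_index // => yE.
  have [lt|ge] := ltnP (index x s).+1 (size s).
    by rewrite yE index_uniq //=; case: (odd _).
  by rewrite yE nth_default // (negbTE gs) in ys.
move=> a b al bl; have := cl a b; rewrite !inE al bl !orbT => h /h[] // E.
  exact: flip.
by rewrite eq_sym; apply: flip.
Qed.

Variable L : F -> seq F.
Hypotheses (mem_L : forall f g, (g \in L f) = e f g).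
Hypotheses (L_uniq : forall f, uniq (L f)) (L_cycle : forall f, path.cycle e (L f)).
Hypothesis L_chordless : forall f, chordless (L f).
Hypothesis L_size : forall f, L f != [::] -> 3 < size (L f).

(** Removing [g] opens the link of [f], an induced cycle, into an induced path
    between the two neighbours of [g] on it.  A path is properly coloured by the
    parity of positions, whatever the parity of the link was. *)
Lemma strip f g : e f g -> exists s k,
  [/\ uniq s, sorted e s, (forall x, (x \in s) = e f x && (x != g)),
      size s = (size (L f)).-1 & proper_on k s]
  /\ {in s, forall x, e g x -> x = head g s \/ x = last g s}
  /\ (e g (head g s) /\ e g (last g s)).
Proof.
move=> fg; have gL : g \in L f by rewrite mem_L.
have [i s rs] := rot_to gL.
have us : uniq (g :: s) by rewrite -rs rot_uniq.
have cs : chordless (g :: s).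
  move=> a b; rewrite -rs !mem_rot !next_rot // => al bl; exact: L_chordless.
have : path.cycle e (g :: s) by rewrite -rs rot_cycle.
have sz : size (L f) = (size s).+1 by have := size_rot i (L f); rewrite rs.
have s3 : 2 < size s.
  by rewrite -ltnS -sz L_size //; case: (L f) gL.
have ns : s != [::] by case: (s) s3.
move=> cyc; exists s, (fun x => odd (index x s)).
case/andP: (us : (g \notin s) && uniq s) => gs us'.
do !split=> //.
- by move: cyc; case: (s) => //= y s'; rewrite rcons_path => /and3P[].
- move=> x; rewrite -mem_L -(mem_rot i (L f)) rs inE.
  by case: eqP => [->|] /=; rewrite ?andbT ?(negbTE gs).
- by rewrite sz.
- exact: proper_on_chordless_behead us cs.
- move=> x xs gx; have := cs g x; rewrite !inE eqxx xs orbT => /(_ isT isT gx)[].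
    by move=> ->; left; rewrite next_nth mem_head /= eqxx /= nth0.
  rewrite next_cons_index // => gE; right.
  have [lt|ge] := ltnP (index x s).+1 (size s).
    by have := mem_nth g lt; rewrite -gE (negbTE gs).
  rewrite -nth_last; have -> : (size s).-1 = index x s.
    have := xs; rewrite -index_mem; lia.
  by rewrite nth_index.
- by move: cyc ns; case: (s) => //= y s' /andP[].
move: cyc ns; case: (s) => //= y s'.
by rewrite rcons_path [e g (last _ _)]es => /and3P[].
Qed.

Lemma head_seq_rev (x : F) s : head x (rev s) = last x s.
Proof. by case/lastP: s => // s y; rewrite rev_rcons last_rcons. Qed.

Lemma last_seq_rev (x : F) s : last x (rev s) = head x s.
Proof. by rewrite -head_seq_rev revK. Qed.

(** The path around [f] can be read in both directions; this fixes the one that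
    ends at a prescribed common neighbour, so that the paths around [f] and [g]
    can be glued into a ring. *)
Lemma strip_to f g w : e f g -> e f w -> e g w -> exists s k,
  [/\ uniq s, sorted e s, (forall x, (x \in s) = e f x && (x != g)),
      size s = (size (L f)).-1 & proper_on k s]
  /\ {in s, forall x, e g x -> x = head g s \/ x = last g s}
  /\ e g (head g s) /\ last g s = w.
Proof.
move=> fg fw gw; have [s [k [[us ss ms zs ks] [hl [gh gl]]]]] := strip fg.
have ws : w \in s by rewrite ms fw; apply: contraTneq gw => ->; rewrite ei.
case: (hl w ws gw) => wE; last by exists s, k.
exists (rev s), k; rewrite head_seq_rev last_seq_rev; do !split=> //.
- by rewrite rev_uniq.
- by rewrite rev_sorted; have := ss; rewrite (eq_sorted (e' := fun x y => e y x)).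
- by move=> x; rewrite mem_rev ms.
- by rewrite size_rev.
- by move=> a b; rewrite !mem_rev; apply: ks.
by move=> x; rewrite mem_rev => xs /(hl _ xs)[]; [right|left].
Qed.

(** The colouring takes opposite corners together; the absence of both diagonals
    makes it proper. *)
Lemma square_hole x f g y : e x f -> e f g -> e g y -> e y x ->
  x != g -> y != f -> ~~ e x g -> ~~ e f y -> exists c k, bipartite_cycle c k.
Proof.
move=> xf fg gy yx nxg nyf exg efy.
have ne a b : e a b -> a != b by apply: contraTneq => ->; rewrite ei.
have [nfx ngf ngy] : [/\ f != x, f != g & y != g].
  by rewrite eq_sym (ne x) // (ne f) // eq_sym (ne g).
have nyx := ne _ _ yx.
exists [:: x; f; g; y], (fun z => (z == x) || (z == g)); split.
  apply/and3P; split=> //=; first by rewrite xf fg gy yx.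
  rewrite !inE !negb_or eq_sym nfx nxg eq_sym nyx ngf eq_sym nyf.
  by rewrite eq_sym ngy.
have gx : ~~ e g x by rewrite es.
have yf : ~~ e y f by rewrite es.
move=> a b; rewrite !inE => /or4P[] /eqP-> /or4P[] /eqP->;
  rewrite ?ei ?(negbTE exg) ?(negbTE efy) ?(negbTE gx) ?(negbTE yf) ?eqxx
    ?orbT //= ?(negbTE nfx) ?(negbTE ngf) ?(negbTE nyx) ?(negbTE ngy) //.
Qed.

(** A link of even length is itself such a cycle.  If the links of two adjacent
    vertices [f] and [g] both have odd length, then the ring around the edge
    [f g] has even length, the sum of both lengths minus 4.  A chord of the ring
    within one of the links is excluded, and a chord [x y] from the link of [f]
    to the link of [g] gives the induced square [x f g y]. *)
Theorem even_hole f0 : L f0 != [::] -> exists c k, bipartite_cycle c k.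
Proof.
have even_link f : L f != [::] -> ~~ odd (size (L f)) ->
    exists c k, bipartite_cycle c k.
  move=> nf ev; exists (L f), (fun x => odd (index x (L f))); split.
    by apply/and3P; split; rewrite ?L_cycle ?L_uniq //; rewrite ltnW // L_size.
  exact: proper_on_chordless.
move=> nf; case: (boolP (odd (size (L f0)))) => [oddf|]; last exact: even_link.
have [g fg] : exists g, e f0 g.
  by case E: (L f0) nf => [//|g l] _; exists g; rewrite -mem_L E mem_head.
have ng : L g != [::].
  by have := mem_L g f0; rewrite es fg; case: (L g).
case: (boolP (odd (size (L g)))) => [oddg|]; last exact: even_link.
have [s [k [[us ss ms zs ks] [hls [gh gl]]]]] := strip fg.
have fs x : x \in s -> e f0 x by rewrite ms => /andP[].
have s3 : 2 < size s by rewrite zs; case: (size _) (L_size nf).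
have hs : head g s \in s by case: (s) s3 => //= y s' _; rewrite mem_head.
have ls : last g s \in s by case: (s) s3 => //= y s' _; rewrite mem_last.
have gf : e g f0 by rewrite es.
have [t [m [[ut st mt zt kt] [hlt [fh lw]]]]] := strip_to gf gh (fs _ hs).
have t3 : 2 < size t by rewrite zt; case: (size _) (L_size ng).
have hw : head f0 t = last g s.
  have lst : last g s \in t.
    by rewrite mt gl; apply: contraTneq (fs _ ls) => ->; rewrite ei.
  case: (hlt _ lst (fs _ ls)) => [//|]; rewrite lw => E.
  case: (s) us s3 E => [|y [|z s']] //= /andP[ys _] _ E.
  by rewrite -E mem_last in ys.
(* If no chord gives an induced square, then [s] and the interior [t'] of [t] form
   the ring around the edge [f0 g]. *)
case: (boolP (has (fun x => has (fun y => [&& e y x, ~~ e x g & ~~ e f0 y]) t) s)).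
  case/hasP=> x xs /hasP[y yt /and3P[yx nxg nfy]].
  move: yt; rewrite mt => /andP[gy yf].
  have xf : e x f0 by rewrite es fs.
  have xg : x != g by move: xs; rewrite ms => /andP[].
  exact: (square_hole xf fg gy yx).
move=> /hasPn good.
have xt x : x \in s -> (x \in t) = e g x.
  move=> xs; rewrite mt andb_idr // => _.
  by apply: contraTneq (fs _ xs) => ->; rewrite ei.
(* The two colourings agree at the two common neighbours, up to exchanging the
   colours: both paths have an even number of vertices. *)
pose K x := if x \in s then k x else m x (+) m (head g s) (+) k (head g s).
have Kt x : x \in t -> K x = m x (+) m (head g s) (+) k (head g s).
  rewrite /K; case: ifP => // xs; rewrite xt // => /(hls _ xs)[] ->.
    by rewrite addbb.
  have -> : k (last g s) = ~~ k (head g s).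
    case: (s) ss ks zs s3 => //= y s' p ks zs _.
    rewrite (proper_on_last p ks).
    have -> : odd (size s').
      by case: (size (L f0)) zs oddf => //= n <-; rewrite /= negbK.
    by case: (k _).
  have -> : m (head g s) = ~~ m (last g s).
    rewrite -lw -hw; case: (t) st kt zt t3 => //= y t' p kt zt _.
    rewrite (proper_on_last p kt).
    have -> : odd (size t').
      by case: (size (L g)) zt oddg => //= n <-; rewrite /= negbK.
    by case: (m _).
  by case: (m _) (k _) => [] [].
have [t' tE] : exists t', t = last g s :: rcons t' (head g s).
  case: (t) t3 hw lw => // y t0 + /= -> E; case/lastP: t0 E => // t0 z.
  by rewrite last_rcons => -> _; exists t0.
have sub_t x : x \in t' -> x \in t.
  by rewrite tE inE mem_rcons inE => ->; rewrite !orbT.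
have disj x : x \in s -> x \in t' -> False.
  move=> xs xt'; have := sub_t _ xt'; rewrite xt // => /(hls _ xs) E.
  move: ut; rewrite tE /= mem_rcons inE rcons_uniq !negb_or -!andbA.
  by case: E xt' => -> ->; rewrite ?andbF.
exists (s ++ t'), K; split.
  apply/and3P; split.
  - by rewrite size_cat ltn_addr.
  - move: ss st s3; rewrite tE; case: (s) => //= y s' ps.
    by rewrite rcons_cat cat_path ps.
  rewrite cat_uniq us /=; apply/andP; split.
    by apply/hasPn=> x xt'; apply/negP=> xs; apply: disj xs xt'.
  by move: ut; rewrite tE /= rcons_uniq => /and3P[].
have mixed a b : a \in s -> b \in t' -> e a b -> K a != K b.
  move=> as_ bt' ab; have bt := sub_t _ bt'; case: (boolP (a \in t)) => at_.
    by rewrite !Kt // !(inj_eq (@addIb _)); apply: kt.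
  have /hasPn/(_ _ bt) := good _ as_; rewrite es ab /= negb_and !negbK.
  case/orP=> [ag|fb]; first by rewrite xt // es ag in at_.
  case: (disj b) => //; rewrite ms fb /=.
  by apply: contraTneq bt => ->; rewrite mt ei.
move=> a b; rewrite !mem_cat => /orP[as_|at_] /orP[bs|bt] ab.
- by rewrite /K as_ bs; apply: ks.
- exact: mixed.
- by rewrite eq_sym; apply: mixed; rewrite // es.
by rewrite !Kt ?sub_t // !(inj_eq (@addIb _)); apply: kt; rewrite ?sub_t.
Qed.

End EvenHole.

(** * Cuts and boundaries modulo 2 *)

Section Incidence.

Local Open Scope ring_scope.

Variables (D : finType) (r : D -> D).
Hypotheses (rK : involutive r) (rN : forall d, r d != d).

(** One dart of each edge: the ranks serve as an arbitrary orientation. *)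
Definition half_darts : {set D} := [set d | (enum_rank d < enum_rank (r d))%N].

Lemma half_darts_rev d : (r d \in half_darts) = (d \notin half_darts).
Proof.
rewrite !inE rK -leqNgt ltn_neqAle andb_idl // => _.
by apply: contra (rN d) => /eqP/val_inj/enum_rank_inj ->.
Qed.

Lemma sum_half (V : nmodType) (g : D -> V) :
  \sum_d g d = \sum_(d in half_darts) (g d + g (r d)).
Proof.
rewrite (bigID [in half_darts]) /= big_split /=; congr (_ + _).
rewrite (reindex_inj (inv_inj rK)) /=; apply: eq_bigl => d.
by rewrite half_darts_rev negbK.
Qed.

Lemma card_half : #|D| = #|half_darts|.*2.
Proof.
by have := sum_half (fun=> 1%N); rewrite sum1_card sum_nat_const -muln2.
Qed.

Lemma natr2 n : n%:R = (odd n)%:R :> 'F_2.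
Proof. by rewrite -[LHS]Zp_nat_mod // modn2. Qed.

Lemma F2_bool (x : 'F_2) : x = (x != 0)%:R.
Proof. by case: x => [[|[|n]] i] //; apply: val_inj. Qed.

(** For the tails of darts this says that the graph is connected, and for the
    faces of darts that the dual graph is. *)
Definition connecting (S : finType) (l : D -> S) :=
  forall u : S -> 'F_2, (forall d, u (l (r d)) = u (l d)) ->
  forall d d', u (l d) = u (l d').

(** For the tails of darts this is the vertex-edge incidence matrix, whose rows
    span the cuts; for the faces of darts it is the face-edge incidence matrix,
    whose rows span the boundaries.  An edge with both sides in one face
    contributes 0. *)
Definition incidence (S : finType) (l : D -> S) :
    'M['F_2]_(#|l @: setT|, #|half_darts|) :=
  \matrix_(i, j) ((l (enum_val j) == enum_val i)%:R
                  + (l (r (enum_val j)) == enum_val i)%:R).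

Lemma mul_incidence (S : finType) (l : D -> S) (u : S -> 'F_2) :
  (\row_i u (enum_val i)) *m incidence l =
  \row_j (u (l (enum_val j)) + u (l (r (enum_val j)))).
Proof.
apply/rowP=> j; rewrite !mxE.
have pick d : \sum_(i < #|l @: setT|) u (enum_val i) *
     (l d == enum_val i)%:R = u (l d).
  have ld : l d \in l @: setT by rewrite imset_f.
  rewrite (bigD1 (enum_rank_in ld (l d))) //= enum_rankK_in // eqxx mulr1.
  rewrite big1 ?addr0 // => i ni; suff /negbTE -> : l d != enum_val i.
    by rewrite mulr0.
  by apply: contra ni => /eqP e; rewrite -(inj_eq enum_val_inj) enum_rankK_in // e.
rewrite -!pick -big_split /=; apply: eq_bigr => i _.
by rewrite !mxE mulrDr.
Qed.

Lemma row_of_fun (S : finType) (A : {set S}) (v : 'rV['F_2]_#|A|) :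
  exists u : S -> 'F_2, v = \row_i u (enum_val i).
Proof.
exists (fun s => \sum_(i | enum_val i == s) v 0 i).
apply/rowP=> i; rewrite mxE (bigD1 i) //= big1 ?addr0 // => j /andP[/eqP e].
by rewrite (enum_val_inj e) eqxx.
Qed.

(** Connectedness leaves only the constant functions in the left kernel. *)
Lemma rank_incidence (S : finType) (l : D -> S) :
  connecting l -> (#|l @: setT| <= (\rank (incidence l)).+1)%N.
Proof.
move=> sl; have := mxrank_ker (incidence l).
suff : (\rank (kermx (incidence l)) <= 1)%N by lia.
apply: (leq_trans (mxrankS (B := const_mx 1 : 'rV_#|l @: setT|) _)); last first.
  exact: rank_leq_row.
apply/row_subP=> i; set v := row i _.
have : v *m incidence l = 0 by rewrite -row_mul mulmx_ker row0.
have [u ->] := row_of_fun v; rewrite mul_incidence => /rowP z.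
have inv d : d \in half_darts -> u (l (r d)) = u (l d).
  move=> hd; have := z (enum_rank_in hd d); rewrite !mxE enum_rankK_in //.
  by move/eqP; rewrite addr_eq0 oppr_pchar2 // => /eqP.
have cst : forall d d', u (l d) = u (l d').
  apply: sl => d; case: (boolP (d \in half_darts)) => [|hd]; first exact: inv.
  by have := inv (r d); rewrite half_darts_rev rK => /(_ hd).
case: (pickP D) => [d _|D0]; last first.
  suff -> : \row_i u (enum_val i) = 0 :> 'rV_#|l @: setT| by rewrite sub0mx.
  by apply/rowP=> j; have /imsetP[d] := enum_valP j; have := D0 d.
apply/sub_rVP; exists (u (l d)); apply/rowP=> j; rewrite !mxE mulr1.
by have /imsetP[d' _ ->] := enum_valP j; exact: cst.
Qed.

Variables (S T : finType) (l : D -> S) (m : D -> T).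
Hypotheses (sl : connecting l) (sm : connecting m).
Hypothesis corners : forall s t,
  #|[set d | (l d == s) && (m d == t)]| = #|[set d | (l d == s) && (m (r d) == t)]|.

Lemma sum_mem (A : pred D) : \sum_d (A d)%:R = #|[set d | A d]|%:R :> 'F_2.
Proof. by rewrite -natr_sum -big_mkcond sum1dep_card. Qed.

(** Summed over darts instead of edges, an entry counts the darts labelled [s] by
    [l] that have label [t] on one side or on the other; by [corners], both
    numbers are equal, so they cancel. *)
Lemma incidence_orth : incidence l *m (incidence m)^T = 0.
Proof.
apply/matrixP=> i j; rewrite !mxE.
pose F d : 'F_2 := (l d == enum_val i)%:R *
  ((m d == enum_val j)%:R + (m (r d) == enum_val j)%:R).
transitivity (\sum_d F d).
  rewrite sum_half [RHS]big_enum_val; apply: eq_bigr => k _.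
  by rewrite !mxE /F rK mulrDl [X in _ + _ * X]addrC.
rewrite /F; under eq_bigr do rewrite mulrDr -!natrM !mulnb.
rewrite big_split /= !sum_mem corners -natrD addnn.
by rewrite natr2 odd_double.
Qed.

(** Two orthogonal spaces of dimensions at least [V - 1] and [F - 1] fit in a space
    of dimension [E]. *)
Lemma euler_bound : (#|l @: setT| + #|m @: setT| <= #|half_darts| + 2)%N.
Proof.
have := rank_incidence sl; have := rank_incidence sm.
have /sub_kermxP/mxrankS := incidence_orth; rewrite mxrank_ker mxrank_tr.
have := rank_leq_col (incidence m); lia.
Qed.

(** The combinatorial Jordan curve theorem.  When the Euler characteristic is 2,
    the cut space fills the orthogonal of the space of boundaries by a count of
    dimensions; hence an edge set that meets every face evenly, such as a cycle
    of the dual graph, is a cut. *)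
Lemma even_cut (a : D -> bool) :
  (#|l @: setT| + #|m @: setT| = #|half_darts| + 2)%N ->
  (forall d, a (r d) = a d) ->
  (forall d0, ~~ odd #|[set d | a d && (m d == m d0)]|) ->
  exists x : S -> bool, forall d, a d = x (l d) (+) x (l (r d)).
Proof.
move=> eul ar aev.
pose v : 'rV['F_2]_#|half_darts| := \row_j (a (enum_val j))%:R.
have : (v <= kermx (incidence m)^T)%MS.
  apply/sub_kermxP/rowP=> j; rewrite !mxE.
  pose F d : 'F_2 := (a d)%:R * (m d == enum_val j)%:R.
  transitivity (\sum_d F d).
    rewrite sum_half [RHS]big_enum_val; apply: eq_bigr => k _.
    by rewrite !mxE /F ar -mulrDr.
  rewrite /F; under eq_bigr do rewrite -natrM mulnb.
  have /imsetP[d0 _ ->] := enum_valP j.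
  by rewrite sum_mem natr2 (negbTE (aev d0)).
have /sub_kermxP s := incidence_orth.
have := mxrank_leqif_sup s; rewrite mxrank_ker mxrank_tr => -[rle].
have := rank_incidence sl; have := rank_incidence sm => hm hl.
have -> : (\rank (incidence l) == #|half_darts| - \rank (incidence m))%N.
  have := rank_leq_col (incidence m); lia.
move=> /esym le_l le_v; have /submxP[y] := submx_trans le_v le_l.
have [u ->] := row_of_fun y; rewrite mul_incidence => /rowP e.
have on_half d : d \in half_darts -> a d = (u (l d) != 0) (+) (u (l (r d)) != 0).
  move=> hd; have := e (enum_rank_in hd d); rewrite !mxE enum_rankK_in //.
  rewrite [u (l d)]F2_bool [u (l (r d))]F2_bool.
  by case: (a d) (u (l d) == 0) (u (l (r d)) == 0) => [] [] [].
exists (fun s => u s != 0) => d; case: (boolP (d \in half_darts)) => [|nd].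
  exact: on_half.
by rewrite -ar on_half ?half_darts_rev // rK addbC.
Qed.

End Incidence.

(** * Darts, faces and the Euler characteristic *)

(* From here on, [head] and [rot] are those of darts and of rotation systems. *)
Import Defs.

Section Darts.

Variable G : sgraph.
Implicit Types (d : dart G) (R : rotation_system G).

Lemma tail_rev d : tail (dart_rev G d) = head d. Proof. by rewrite permE. Qed.

Lemma head_rev d : head (dart_rev G d) = tail d. Proof. by rewrite permE. Qed.

Lemma dart_eq d d' : tail d = tail d' -> head d = head d' -> d = d'.
Proof.
rewrite /tail /head => t h; apply: val_inj; move: t h.
by case: (val d) (val d') => [a b] [a' b'] /= -> ->.
Qed.

Lemma dart_adj d : adj (tail d) (head d). Proof. exact: (valP d). Qed.

Lemma dart_of (x y : G) : adj x y -> exists d, tail d = x /\ head d = y.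
Proof. by move=> a; exists (exist (fun p : G * G => adj p.1 p.2) (x, y) a). Qed.

Lemma rev_involutive : involutive (dart_rev G).
Proof. by move=> d; apply: dart_eq; rewrite ?(tail_rev, head_rev). Qed.

Lemma tail_neq_head d : tail d != head d.
Proof. by apply: contraTneq (dart_adj d) => ->; rewrite adj_irrefl. Qed.

Lemma rev_neq d : dart_rev G d != d.
Proof. by apply: contra (tail_neq_head d) => /eqP e; rewrite -{1}e tail_rev. Qed.

Definition dart_edge d : {set G} := [set tail d; head d].

Lemma dart_edge_eq d d' :
  (dart_edge d == dart_edge d') = (d == d') || (d == dart_rev G d').
Proof.
apply/eqP/orP=> [|[] /eqP ->] //; last first.
  by rewrite /dart_edge tail_rev head_rev setUC.
move=> e; have := set21 (tail d) (head d); have := set22 (tail d) (head d).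
rewrite -/(dart_edge d) e !inE; have := tail_neq_head d.
move=> n /orP[] /eqP h /orP[] /eqP t; rewrite ?h ?t ?eqxx // in n.
  by right; apply/eqP/dart_eq; rewrite ?tail_rev ?head_rev.
by left; apply/eqP/dart_eq.
Qed.

Lemma edgesE : edges G = dart_edge @: [set: dart G].
Proof.
apply/setP=> A; apply/imsetP/imsetP=> [[[x y]] /= a ->|[d _ ->]]; last first.
  by exists (tail d, head d); rewrite ?inE ?dart_adj.
by move: a; rewrite inE => /dart_of[d [t h]]; exists d; rewrite ?inE // /dart_edge t h.
Qed.

Lemma card_edges : #|edges G| = #|half_darts (dart_rev G)|.
Proof.
rewrite edgesE -(card_in_imset (f := dart_edge) (D := half_darts (dart_rev G))).
  apply: eq_card => A; apply/imsetP/imsetP=> [] [d hd ->]; last by exists d.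
  case: (boolP (d \in half_darts (dart_rev G))) => [hf|]; first by exists d.
  rewrite -(half_darts_rev rev_involutive rev_neq) => h.
  by exists (dart_rev G d); rewrite // /dart_edge tail_rev head_rev setUC.
move=> d d' hd hd' /eqP; rewrite dart_edge_eq => /orP[] /eqP // e.
by move: hd; rewrite e (half_darts_rev rev_involutive rev_neq) hd'.
Qed.

Lemma card_porbits_rev : #|porbits (dart_rev G)| = #|edges G|.
Proof.
have mem d d' : (d \in porbit (dart_rev G) d') =
    (d == d') || (d == dart_rev G d').
  apply/porbitP/orP=> [[i ->]|[] /eqP ->]; last 2 first.
  - by exists 0; rewrite expg0 perm1.
  - by exists 1%N; rewrite expg1.
  elim: i => [|i]; first by left; rewrite expg0 perm1.
  by rewrite expgSr permM => -[] /eqP ->; [right|left; rewrite rev_involutive].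
rewrite card_edges; set H := half_darts _.
rewrite -(card_in_imset (f := porbit (dart_rev G)) (D := H)).
  apply: eq_card => A; apply/imsetP/imsetP=> [] [d hd ->]; last by exists d.
  case: (boolP (d \in H)) => [hf|]; first by exists d.
  rewrite -(half_darts_rev rev_involutive rev_neq) => h.
  by exists (dart_rev G d) => //; apply/eqP; rewrite eq_porbit_mem mem
    rev_involutive eqxx orbT.
move=> d d' hd hd' /eqP; rewrite eq_porbit_mem mem => /orP[] /eqP // e.
by move: hd; rewrite e (half_darts_rev rev_involutive rev_neq) hd'.
Qed.

Variable R : rotation_system G.

Definition face d : {set dart G} := porbit (face_perm R) d.

Lemma face_permE d : face_perm R d = R (dart_rev G d).
Proof. by rewrite permM. Qed.

Lemma tail_rot d : tail (R d) = tail d.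
Proof. by have := mem_porbit R 1 d; rewrite expg1 rotP => /eqP. Qed.

Lemma tail_face_perm d : tail (face_perm R d) = head d.
Proof. by rewrite face_permE tail_rot tail_rev. Qed.

Lemma face_face_perm d : face (face_perm R d) = face d.
Proof. by have := porbit_perm (face_perm R) 1 d; rewrite expg1. Qed.

Lemma face_rot d : face (R d) = face (dart_rev G d).
Proof. by rewrite -(face_face_perm (dart_rev G d)) face_permE rev_involutive. Qed.

Lemma facesE : faces R = face @: [set: dart G].
Proof.
by apply/setP=> f; apply/imsetP/imsetP=> [] [d _ ->]; exists d; rewrite ?inE.
Qed.

Hypothesis Gconn : connected G.

(** The graph is connected through its darts: moving around a vertex and
    reversing a dart reach all darts from any of them. *)
Lemma connect_tail (T : Type) (u : dart G -> T) :
  (forall d d', tail d = tail d' -> u d = u d') ->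
  (forall d, u (dart_rev G d) = u d) -> forall d d', u d = u d'.
Proof.
move=> ut ur d d'; have /connectP[p] := Gconn.2 (tail d) (tail d').
elim: p d => [|y p IHp] d /=; first by move=> _ /esym/ut.
case/andP=> /dart_of[o [to ho]] pp lp.
by rewrite (ut d o) // -ur; apply: IHp; rewrite tail_rev ho.
Qed.

Lemma connecting_tail : connecting (dart_rev G) (@tail G).
Proof.
by move=> u ur; apply: connect_tail => // d d' ->.
Qed.

Lemma connecting_face : connecting (dart_rev G) face.
Proof.
move=> u ur; apply: connect_tail => // d d' t.
have /porbitP[i ->] : d' \in porbit R d by rewrite rotP t.
elim: i => [|i IHi]; first by rewrite expg0 perm1.
by rewrite expgSr permM face_rot ur.
Qed.

(** The rotation is a bijection from the darts at [v] to themselves, and the face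
    after a dart in the rotation is the face of its reverse. *)
Lemma corners v f : #|[set d | (tail d == v) && (face d == f)]| =
  #|[set d | (tail d == v) && (face (dart_rev G d) == f)]|.
Proof.
rewrite -[RHS](card_imset _ (@perm_inj _ R)); apply: eq_card => d.
have [o ->] : exists o, d = R o by exists ((rot R)^-1%g d); rewrite permKV.
by rewrite (mem_imset _ _ (@perm_inj _ R)) !inE tail_rot face_rot.
Qed.

Hypothesis Gdeg : forall x : G, exists y, adj x y.

Lemma tail_onto : @tail G @: [set: dart G] = setT.
Proof.
apply/setP=> x; rewrite inE; have [y /dart_of[d [<- _]]] := Gdeg x.
by rewrite imset_f.
Qed.

Lemma faces_bound : #|G| + #|faces R| <= #|edges G| + 2.
Proof.
rewrite -cardsT -tail_onto facesE card_edges.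
apply: (euler_bound rev_involutive rev_neq connecting_tail connecting_face corners).
Qed.

Lemma planar_cut (a : dart G -> bool) : embeds_in_genus R 0 ->
  (forall d, a (dart_rev G d) = a d) ->
  (forall d0, ~~ odd #|[set d | a d && (face d == face d0)]|) ->
  exists X : {set G}, forall d, a d = (tail d \in X) (+) (head d \in X).
Proof.
rewrite /embeds_in_genus /euler_char => eul ar aev.
have e : #|@tail G @: [set: dart G]| + #|face @: [set: dart G]| =
         #|half_darts (dart_rev G)| + 2.
  rewrite tail_onto cardsT -facesE -card_edges; move: eul.
  by move: #|G| #|edges G| #|faces R| => v w f; lia.
have [x xP] := even_cut rev_involutive rev_neq connecting_tail connecting_face
  corners e ar aev.
by exists [set v | x v] => d; rewrite !inE xP tail_rev.
Qed.

(** Compare the signatures of the permutations in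
    [face_perm R = dart_rev G * R]: their cycles are the faces, the edges and the
    vertices. *)
Lemma euler_even : ~~ odd (#|G| + #|edges G| + #|faces R|).
Proof.
have /= := odd_permM (dart_rev G) R; rewrite /odd_perm.
have -> : #|porbits R| = #|G|.
  have pt d : porbit R d = [set d' | tail d' == tail d].
    by apply/setP=> d'; rewrite inE rotP.
  pose out v := [set d : dart G | tail d == v].
  have -> : porbits R = out @: [set: G].
    apply/setP=> A; apply/imsetP/imsetP=> [[d _ ->]|[v _ ->]].
      by exists (tail d); rewrite ?pt.
    by have [y /dart_of[d [<- _]]] := Gdeg v; exists d; rewrite ?pt.
  rewrite card_imset ?cardsT //.
  move=> v w /setP e; have [y /dart_of[d [t _]]] := Gdeg v.
  by have := e d; rewrite !inE t eqxx => /esym/eqP.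
rewrite card_porbits_rev -/(face_perm R) -/(faces R) !oddD.
rewrite (card_half rev_involutive rev_neq) odd_double.
by case: (odd #|G|) (odd #|edges G|) (odd _) => [] [] [].
Qed.

Lemma positive_genus : ~ embeds_in_genus R 0 ->
  exists2 g, 0 < g & embeds_in_genus R g.
Proof.
have := faces_bound; have := euler_even; rewrite /embeds_in_genus /euler_char.
move: #|G| #|edges G| #|faces R| => v e f ev le n0.
exists ((2 + e - v - f)./2); lia.
Qed.

End Darts.

(** * Small cuts *)

(** Extend a path at its first vertex until all neighbours of this vertex lie on
    the path; one of them is not the next vertex, and closes a cycle. *)
Lemma cycle_of_min_degree (T : finType) (e : rel T) (X : {set T}) :
  symmetric e -> irreflexive e -> X != set0 ->
  (forall x, x \in X -> 1 < #|[set y in X | e x y]|) ->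
  exists c, is_cycle e c /\ {subset c <= X}.
Proof.
move=> es ei /set0Pn[x0 x0X] deg.
suff grow n : (exists c, is_cycle e c /\ {subset c <= X}) \/
    exists x p, [/\ size p = n, uniq (x :: p), path e x p & {subset x :: p <= X}].
  have [//|[x [p [sp up _ _]]]] := grow #|T|.
  by have := max_card [in x :: p]; rewrite (card_uniqP up) /= sp ltnn.
elim: n => [|n [?|[x [p [sp up ep pX]]]]]; last 2 first.
- by left.
- have xX : x \in X by rewrite pX ?mem_head.
  case: (pickP [pred y in X | e x y & y \notin x :: p]) => [y /and3P[yX xy yp]|N].
    right; exists y, (x :: p); split; rewrite /= ?sp //.
    - by rewrite -/(uniq (x :: p)) yp.
    - by rewrite es xy.
    by move=> z; rewrite inE => /orP[/eqP->|/pX].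
  have [y] : exists y, y \in [set y in X | e x y] :\ seq.head x p.
    apply/set0Pn; rewrite -card_gt0; have := deg x xX.
    by rewrite (cardsD1 (seq.head x p)); case: (_ \in _) => /=; lia.
  rewrite !inE => /and3P[yh yX xy].
  have := N y; rewrite /= yX xy /= inE => /negbFE/orP[/eqP e1|yp].
    by rewrite e1 ei in xy.
  case/splitPr: yp sp up ep pX yh => p1 p2 _ up ep pX yh; left.
  exists (x :: rcons p1 y); split; last first.
    move=> z zc; apply: pX; move: zc; rewrite -cat_rcons !inE mem_cat.
    by case/orP=> ->; rewrite ?orbT.
  move: up ep; rewrite -cat_rcons -cat_cons cat_uniq cat_path => /andP[up _] /andP[ep _].
  apply/and3P; split; rewrite //= ?size_rcons.
    by case: (p1) yh => //=; rewrite eqxx.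
  by rewrite rcons_path ep last_rcons es.
by right; exists x0, [::]; split=> // z; rewrite inE => /eqP->.
Qed.

Section SmallCuts.

Variable G : sgraph.
Implicit Types (d : dart G) (X : {set G}) (v : G).

Definition cut X : {set dart G} := [set d | (tail d \in X) && (head d \notin X)].

Lemma card_cutC X : #|cut (~: X)| = #|cut X|.
Proof.
rewrite -(card_imset _ (@perm_inj _ (dart_rev G))); apply: eq_card => d.
rewrite -[d]rev_involutive (mem_imset _ _ (@perm_inj _ (dart_rev G))) !inE.
by rewrite !(tail_rev, head_rev) negbK andbC.
Qed.

Hypothesis Gcubic : cubic G.

Lemma card_out v : #|[set d : dart G | tail d == v]| = 3.
Proof.
rewrite -(Gcubic v) -(card_in_imset (f := @head G)); last first.
  by move=> d d'; rewrite !inE => /eqP t /eqP t'; apply: dart_eq; rewrite t.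
apply: eq_card => y; rewrite inE; apply/imsetP/idP=> [[d]|/dart_of[d [t h]]].
  by rewrite inE => /eqP <- ->; exact: dart_adj.
by exists d; rewrite ?inE ?t.
Qed.

(** Moving [v] to the other side trades its edges leaving [X] for its edges into
    [X]. *)
Lemma cut_rem X v : v \in X ->
  #|cut (X :\ v)| + #|[set d : dart G | (tail d == v) && (head d \notin X)]|
  <= #|cut X| + #|[set d : dart G | (tail d == v) && (head d \in X)]|.
Proof.
move=> vX; set O := finset _; set I := finset _.
have -> : #|I| = #|[set d : dart G | (tail d \in X) && (head d == v)]|.
  rewrite -(card_imset _ (@perm_inj _ (dart_rev G))); apply: eq_card => d.
  rewrite -[d]rev_involutive (mem_imset _ _ (@perm_inj _ (dart_rev G))) !inE.
  by rewrite !(tail_rev, head_rev) andbC.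
set J := finset _; have OX : O \subset cut X.
  by apply/subsetP=> d; rewrite !inE => /andP[/eqP -> ->]; rewrite vX.
suff : cut (X :\ v) \subset (cut X :\: O) :|: J.
  move=> /subset_leq_card; rewrite cardsU cardsDS //.
  have := subset_leq_card OX.
  by move: #|O| #|J| #|cut X| #|cut _| #|_ :&: _| => o j c c' i; lia.
apply/subsetP=> d; rewrite !inE.
by case: (tail d == v) => //=; case: (tail d \in X) => //=;
   case: (head d == v); case: (head d \in X).
Qed.

(** As long as some vertex has at most one neighbour inside [X], it has two edges
    out of [X], so removing it decreases the cut.  The two cases of the
    hypothesis make sure that the set does not become empty. *)
Lemma cycle_inside X :
  (#|cut X| <= 3) && (1 < #|X|) || (#|cut X| <= 2) && (0 < #|X|) ->
  exists c, is_cycle (@adj G) c /\ {subset c <= X}.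
Proof.
have [n] := ubnP #|X|; elim: n X => // n IHn X ltn hX.
case: (boolP [exists v in X, #|[set y in X | adj v y]| <= 1]); last first.
  move=> /exists_inPn deg; apply: cycle_of_min_degree.
  - exact: adj_sym.
  - exact: adj_irrefl.
  - by rewrite -card_gt0; move: hX; lia.
  by move=> x /deg; rewrite -ltnNge.
case/exists_inP=> v vX dv; have := cut_rem vX; set O := finset _; set I := finset _.
have OI : #|O| + #|I| = 3.
  rewrite -(card_out v) [LHS]addnC.
  rewrite -(cardsID [set d | head d \in X] [set d | tail d == v]).
  by congr addn; apply: eq_card=> d; rewrite !inE // andbC.
have {dv} : #|I| <= 1.
  apply: leq_trans dv; rewrite -(card_in_imset (f := @head G) (D := I)).
    apply/subset_leq_card/subsetP=> y /imsetP[d]; rewrite !inE.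
    by case/andP=> /eqP <- hd ->; rewrite hd dart_adj.
  move=> d d'; rewrite !inE => /andP[/eqP t _] /andP[/eqP t' _].
  by apply: dart_eq; rewrite t.
have OX : #|O| <= #|cut X|.
  by apply/subset_leq_card/subsetP=> d; rewrite !inE => /andP[/eqP -> ->]; rewrite vX.
have IX : #|I| <= #|X :\ v|.
  rewrite -(card_in_imset (f := @head G) (D := I)).
    apply/subset_leq_card/subsetP=> y /imsetP[d]; rewrite !inE.
    by case/andP=> /eqP <- hd ->; rewrite hd eq_sym tail_neq_head.
  move=> d d'; rewrite !inE => /andP[/eqP t _] /andP[/eqP t' _].
  by apply: dart_eq; rewrite t.
have := cardsD1 v X; rewrite vX => cX I1 le.
have ltX : #|X :\ v| < n by lia.
have hXv : (#|cut (X :\ v)| <= 3) && (1 < #|X :\ v|) ||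
           (#|cut (X :\ v)| <= 2) && (0 < #|X :\ v|).
  move: OI I1 OX IX hX le cX.
  move: #|O| #|I| #|cut X| #|cut _| #|X| #|X :\ v| => o i c c' x x'; lia.
have [c [cc cs]] := IHn _ ltX hXv; exists c; split=> //.
by move=> z /cs; rewrite inE => /andP[].
Qed.

Hypothesis Gcyc : cyclically_edge_connected 4 G.

(** By [cycle_inside], a side of such a cut contains a cycle as soon as it has two
    vertices, and this may not happen on both sides.  All later uses of cyclic
    4-edge connectivity go through this lemma. *)
Lemma small_cut X : #|cut X| <= 3 -> #|X| <= 1 \/ #|~: X| <= 1.
Proof.
move=> cX; case: (leqP #|X| 1) => [|X1]; first by left.
case: (leqP #|~: X| 1) => [|Y1]; first by right.
have [|c1 [cc1 s1]] := @cycle_inside X; first by rewrite cX X1.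
have [|c2 [cc2 s2]] := @cycle_inside (~: X); first by rewrite card_cutC cX Y1.
pose A := @dart_edge G @: cut X.
have inA x y : adj x y -> (x \in X) = (y \in X) -> delete_edges A x y.
  move=> axy xy; apply/andP; split=> //; apply/imsetP=> -[d].
  rewrite inE => /andP[t h] e.
  have := set21 (tail d) (head d); have := set22 (tail d) (head d).
  rewrite -/(dart_edge d) -e !inE => /orP[] /eqP hd /orP[] /eqP td;
    by move: t h; rewrite hd td ?xy => ->.
have crossA x y : delete_edges A x y -> x \in X -> y \in X.
  move=> /andP[/dart_of[d [t h]] nA] xX; apply: contraR nA => yX.
  by apply/imsetP; exists d; rewrite ?inE /dart_edge t h ?xX.
have cycA c (Y : {set G}) : is_cycle (@adj G) c -> {subset c <= Y} ->
    {in Y &, forall x y : G, (x \in X) = (y \in X)} ->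
    exists2 x, x \in Y & component_has_cycle (delete_edges A) x.
  move=> /and3P[sc cc uc] cY YX; case: c sc cc uc cY => // x c sc cc uc cY.
  have ccA : path.cycle (delete_edges A) (x :: c).
    apply: (sub_in_cycle (P := [in Y]) _ _ cc); last exact/allP.
    by move=> y z yY zY yz; apply: inA; rewrite // (YX y z).
  exists x; first by rewrite cY ?mem_head.
  exists (x :: c); split; first by apply/and3P.
  by move=> y yc; apply: (connect_cycle ccA); rewrite ?mem_head.
have [x xX hx] : exists2 x, x \in X & component_has_cycle (delete_edges A) x.
  by apply: (cycA c1) => // x y -> ->.
have [y yX hy] : exists2 y, y \in ~: X & component_has_cycle (delete_edges A) y.
  by apply: (cycA c2) => // u w; rewrite !inE => /negbTE-> /negbTE->.
case: (Gcyc (A := A)).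
- by rewrite edgesE imsetS // subsetT.
- by rewrite ltnS (leq_trans (leq_imset_card _ _)).
exists x, y; split=> //; apply/connectP=> -[p].
elim: p x xX {hx} => [|z p IHp] x xX /=.
  by move=> _ e; rewrite inE e xX in yX.
by case/andP=> xz pz lz; apply: (IHp z); rewrite // (crossA x z).
Qed.

End SmallCuts.

(** * Faces of a planar embedding *)

Section Planar.

Variable G : sgraph.
Hypotheses (Gconn : connected G) (Gcubic : cubic G).
Implicit Types (d o x y : dart G).

Local Notation rev := (dart_rev G).

Lemma cubic_deg (v : G) : exists w, adj v w.
Proof.
have /card_gt0P[w] : 0 < #|[set w | adj v w]| by rewrite Gcubic.
by rewrite inE; exists w.
Qed.

Section Rotation.

Variable R : rotation_system G.

Lemma card_porbit_rot d : #|porbit R d| = 3.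
Proof.
by rewrite -(card_out Gcubic (tail d)); apply: eq_card => o; rewrite inE rotP.
Qed.

Lemma porbit_rot d : porbit R d =i [:: d; R d; R (R d)].
Proof. by move=> o; rewrite porbit_traject card_porbit_rot. Qed.

Lemma rot3 d : R (R (R d)) = d.
Proof. by have := iter_porbit R d; rewrite card_porbit_rot. Qed.

Lemma rot_neq d : R d != d.
Proof.
apply/eqP=> e; have := card_out Gcubic (tail d).
have -> : [set o | tail o == tail d] = [set d].
  apply/setP=> o; rewrite !inE -(rotP R) porbit_rot !inE !e.
  by case: (o == d).
by rewrite cards1.
Qed.

Lemma same_tail d d' : tail d = tail d' -> d != d' -> d' = R d \/ d = R d'.
Proof.
move=> t n; have : d' \in porbit R d by rewrite rotP t.
rewrite porbit_rot !inE eq_sym (negbTE n) /= => /orP[] /eqP->; first by left.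
by right; rewrite rot3.
Qed.

(** Any two of the three darts at a vertex follow each other in the rotation, in
    one order or in the other. *)
Lemma adj_face d d' : tail d = tail d' -> d != d' ->
  exists o, face R o = face R d /\ face R (rev o) = face R d'.
Proof.
move=> t n; have [->|->] := same_tail t n.
  by exists d; rewrite face_rot.
by exists (rev d'); rewrite rev_involutive face_rot.
Qed.

(** A face of length 2 would be an edge traversed back and forth, so its end
    would have degree 1. *)
Lemma face_size_gt2 d : 2 < #|porbit (face_perm R) d|.
Proof.
have := card_porbit_neq0 (face_perm R) d; have := iter_porbit (face_perm R) d.
case: #|_| => [|[|[|n]]] //= fd _.
  by have := tail_neq_head d; rewrite -{1}fd tail_face_perm eqxx.
have E : face_perm R d = rev d.
  apply: dart_eq; rewrite ?tail_rev ?head_rev ?tail_face_perm //.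
  by rewrite -(tail_face_perm R) fd.
by have := rot_neq (rev d); rewrite -face_permE E eqxx.
Qed.

(** A way to see that no facial walk returns to a vertex without computing the
    faces: it is enough to label the darts so that the label is constant along
    faces and tells the darts at each vertex apart. *)
Lemma strong_of_labels (T : eqType) (lab : dart G -> T) :
  (forall d, lab (face_perm R d) = lab d) ->
  (forall d d', tail d = tail d' -> d != d' -> lab d != lab d') -> strong R.
Proof.
move=> labF labN d; set n := #|porbit (face_perm R) d|.
have n0 : n != 0 := card_porbit_neq0 _ _.
have fn : iter n (face_perm R) d = d := iter_porbit _ _.
have lab_traj x : x \in traject (face_perm R) d n -> lab x = lab d.
  by case/trajectP=> i _ ->; elim: i => //= i <-.
apply/and3P; split.
- by rewrite size_map size_traject face_size_gt2.
- rewrite /facial_walk -/n.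
  case: n n0 fn {lab_traj} => // n _ fn /=; rewrite -map_rcons.
  have -> : rcons (traject (face_perm R) (face_perm R d) n) d =
            traject (face_perm R) (face_perm R d) n.+1.
    by rewrite trajectSr -iterSr fn.
  rewrite path_map.
  apply: sub_path (fpath_traject _ _ _) => x y /eqP <- /=.
  by rewrite tail_face_perm dart_adj.
rewrite map_inj_in_uniq ?uniq_traject_porbit //.
move=> x y xt yt txy; apply/eqP; apply: contraT => n_xy.
by have := labN _ _ txy n_xy; rewrite !lab_traj ?eqxx.
Qed.

Hypothesis Gcyc : cyclically_edge_connected 4 G.
Hypothesis Rplanar : embeds_in_genus R 0.

(** Edges that meet every face evenly form a cut, and a cut of at most three edges
    isolates a single vertex.  The edges are given by the list of their darts, two
    for each edge. *)
Lemma even_edges_at_vertex (s : seq (dart G)) : uniq s -> s != [::] -> size s <= 6 ->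
  (forall d, (rev d \in s) = (d \in s)) ->
  (forall d0, ~~ odd (count (fun d => face R d == face R d0) s)) ->
  exists v, forall d, (d \in s) = (tail d == v) || (head d == v).
Proof.
move=> us ns s6 rs ev.
have [||X sX] := planar_cut Gconn cubic_deg (a := [in s]) Rplanar.
- exact: rs.
- move=> d0; rewrite (_ : #|_| = count (fun d => face R d == face R d0) s) ?ev //.
  rewrite -size_filter -(card_uniqP (filter_uniq _ us)).
  by apply: eq_card => d; rewrite inE mem_filter andbC.
have cX : #|cut X| <= 3.
  have : #|cut X| + #|cut (~: X)| <= 6.
    apply: leq_trans s6; rewrite -(card_uniqP us) -cardsUI.
    rewrite (_ : _ :&: _ = set0) ?cards0 ?addn0.
      apply/subset_leq_card/subsetP=> d; rewrite !inE sX.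
      by case: (tail d \in X); case: (head d \in X).
    by apply/setP=> d; rewrite !inE; case: (tail d \in X); rewrite /= ?andbF.
  by rewrite card_cutC addnn -[6]/(3.*2) leq_double.
have [d ds] : exists d, d \in s.
  by case: (s) ns => // d l _; exists d; rewrite mem_head.
have one (Y : {set G}) : #|Y| <= 1 ->
    (forall d, (d \in s) = (tail d \in Y) (+) (head d \in Y)) ->
    exists v, forall d, (d \in s) = (tail d == v) || (head d == v).
  move=> cY sY; have : #|Y| != 0.
    apply/eqP=> /cards0_eq Y0; have := sY d.
    by rewrite ds Y0 !inE.
  move=> Y0; have /cards1P[v Yv] : #|Y| == 1 by rewrite eqn_leq cY lt0n.
  exists v => o; rewrite sY Yv !inE; case: (eqVneq (tail o) v) => // <- /=.
  by rewrite eq_sym (negbTE (tail_neq_head o)).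
case: (small_cut Gcubic Gcyc cX) => cY; first exact: one cY sX.
apply: one cY _ => o; rewrite sX !inE.
by case: (tail o \in X); case: (head o \in X).
Qed.

(** The edges at a vertex of a cubic graph are three, so fewer edges cannot meet
    every face evenly. *)
Lemma even_edges_gt5 (s : seq (dart G)) : uniq s -> s != [::] -> size s <= 6 ->
  (forall d, (rev d \in s) = (d \in s)) ->
  (forall d0, ~~ odd (count (fun d => face R d == face R d0) s)) ->
  5 < size s.
Proof.
move=> us ns s6 rs ev; have [v sv] := even_edges_at_vertex us ns s6 rs ev.
pose A := [set d : dart G | tail d == v].
have : #|A| + #|rev @: A| <= size s.
  rewrite -(card_uniqP us) -cardsUI (_ : _ :&: _ = set0) ?cards0 ?addn0.
    apply/subset_leq_card/subsetP=> d; rewrite inE sv => /orP[].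
      by rewrite inE => ->.
    by case/imsetP=> o; rewrite inE => /eqP to ->; rewrite head_rev to eqxx orbT.
  apply/setP=> d; rewrite !inE; apply/negbTE/negP=> /andP[/eqP td].
  case/imsetP=> o; rewrite inE => /eqP to dE.
  by have := tail_neq_head d; rewrite td dE head_rev to eqxx.
by rewrite (card_imset _ (@perm_inj _ _)) (card_out Gcubic).
Qed.

(** Otherwise the edge of [d] would meet every face evenly. *)
Lemma face_rev_neq d : face R d != face R (rev d).
Proof.
apply/eqP=> e; suff : 5 < size [:: d; rev d] by [].
apply: even_edges_gt5 => //=.
- by rewrite inE eq_sym rev_neq.
- by move=> o; rewrite !inE !(inv_eq (@rev_involutive G)) rev_involutive orbC.
by move=> d0; rewrite -e; case: (_ == _).
Qed.

(** Two faces share at most one edge: two common edges would meet every face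
    evenly. *)
Lemma face_pair_inj d d' : face R d = face R d' ->
  face R (rev d) = face R (rev d') -> d = d'.
Proof.
move=> e er; apply/eqP/negPn/negP=> n.
suff : 5 < size [:: d; rev d; d'; rev d'] by [].
have nr o o' : face R o = face R o' -> o != rev o'.
  by move=> h; apply: contraTneq (face_rev_neq o') => <-; rewrite h eqxx.
apply: even_edges_gt5 => //=.
- rewrite !inE !negb_or (inj_eq (@perm_inj _ rev)) n eq_sym rev_neq nr //=.
  by rewrite eq_sym nr //= eq_sym rev_neq.
- move=> o; rewrite !inE !(inv_eq (@rev_involutive G)) !rev_involutive.
  by rewrite orbCA; congr (_ || (_ || _)); rewrite orbC.
move=> d0; rewrite e er.
by case: (face R d' == _); case: (face R _ == _).
Qed.

(** Three faces that pairwise share an edge meet at a vertex: their three common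
    edges meet every face evenly, so they are the edges at a vertex.  In the dual
    triangulation, this says that every triangle bounds a cell. *)
Lemma three_faces d1 d2 d3 : face R (rev d1) = face R d2 ->
  face R (rev d2) = face R d3 -> face R (rev d3) = face R d1 ->
  d1 = R d3 \/ rev d3 = R (rev d1).
Proof.
move=> e1 e2 e3; set f := face R d1; set g := face R d2; set h := face R d3.
have fg : f != g by rewrite /f /g -e1 face_rev_neq.
have gh : g != h by rewrite /g /h -e2 face_rev_neq.
have hf : h != f by rewrite /f /h -e3 face_rev_neq.
pose s := [:: d1; rev d1; d2; rev d2; d3; rev d3].
have rs o : (rev o \in s) = (o \in s).
  rewrite !inE !(inv_eq (@rev_involutive G)) !rev_involutive.
  rewrite orbCA; congr (_ || (_ || _)); rewrite orbCA; congr (_ || (_ || _)).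
  by rewrite orbC.
have [|||||v sv] := @even_edges_at_vertex s.
- apply: (@map_uniq _ _ (fun d => (face R d, face R (rev d)))).
  rewrite /= !rev_involutive e1 e2 e3 -/f -/g -/h !inE !xpair_eqE.
  rewrite (eq_sym g f) (eq_sym h g) (eq_sym f h).
  by rewrite !(negbTE fg, negbTE gh, negbTE hf, eqxx, andbF, andFb, andbT, orbF).
- by [].
- by [].
- exact: rs.
- by move=> d0; rewrite /= e1 e2 e3 -/f -/g -/h;
  case: (f == _); case: (g == _); case: (h == _).
(* The dart before [d1] or after [rev d1] in the rotation also has a side in [f],
   and besides [d1] only the edge of [d3] does. *)
have faces_in o : o \in s -> face R (rev o) = f -> o = rev d1 \/ o = d3.
  rewrite !inE => /or4P[|||/or3P[]] /eqP ->;
    rewrite ?rev_involutive ?e1 ?e2 ?e3 -/f -/g -/h.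
  - by move=> E; rewrite -E eqxx in fg.
  - by left.
  - by move=> E; rewrite E eqxx in hf.
  - by move=> E; rewrite -E eqxx in fg.
  - by right.
  - by move=> E; rewrite E eqxx in hf.
have preR o : exists o', o = R o' by exists ((rot R)^-1%g o); rewrite permKV.
have : d1 \in s by rewrite mem_head.
rewrite sv => /orP[] /eqP tv.
  have [o oE] := preR d1; left.
  have os : o \in s by rewrite sv -(tail_rot R o) -oE tv eqxx.
  have /(faces_in _ os)[E|<- //] : face R (rev o) = f by rewrite -face_rot -oE.
  by have := tail_neq_head d1; rewrite {1}oE tail_rot E tail_rev eqxx.
right; set o := R (rev d1).
have os : rev o \in s.
  by rewrite rs sv tail_rot tail_rev tv eqxx.
have fo : face R (rev (rev o)) = f by rewrite rev_involutive face_rot rev_involutive.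
case: (faces_in _ os fo) => [|<-]; last by rewrite rev_involutive.
move=> /perm_inj oE; have := tail_neq_head d1.
by rewrite -[in tail _]oE tail_rot tail_rev eqxx.
Qed.

Hypothesis GnotK4 : ~ complete G.

(** The three edges leaving a triangular face would form a small cut, with at most
    one vertex outside of the triangle, so the graph would have at most four
    vertices and be complete. *)
Lemma face_size d : 3 < #|porbit (face_perm R) d|.
Proof.
set n := #|_|; have fn : iter n (face_perm R) d = d := iter_porbit _ _.
have n2 : 2 < n := face_size_gt2 d.
case: n n2 fn => [|[|[|[|n]]]] //= _ fd.
set x := face_perm R d in fd *; set y := face_perm R x in fd *.
have [hd hx hy] : [/\ head d = tail x, head x = tail y & head y = tail d].
  by split; rewrite -(tail_face_perm R) ?fd.
have nxd : tail x != tail d by rewrite -hd eq_sym tail_neq_head.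
have nyx : tail y != tail x by rewrite -hx eq_sym tail_neq_head.
have nyd : tail y != tail d by rewrite -hy tail_neq_head.
pose X := [set tail d; tail x; tail y].
have c3 : #|X| = 3.
  by rewrite /X setUC cardsU1 cards2 !inE negb_or nyd nyx eq_sym nxd.
(* At each vertex of the triangle, two darts run along the triangle, and only the
   third one may leave it. *)
have third z o : tail z \in X -> head (face_perm R z) \in X ->
    o \in cut X -> tail o = head z -> o = R (R (rev z)).
  move=> zX fzX; rewrite inE => /andP[_ oX] to.
  have : o \in porbit R (rev z) by rewrite rotP tail_rev to.
  rewrite porbit_rot !inE => /or3P[] /eqP oE //; move: oX; rewrite oE.
    by rewrite head_rev zX.
  by rewrite -face_permE fzX.
have cX : #|cut X| <= 3.
  pose out z := R (R (rev z)).
  have : cut X \subset [set out d; out x; out y].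
    apply/subsetP=> o oX; have oX' := oX; rewrite !inE /out.
    move: oX'; rewrite inE => /andP[+ _]; rewrite !inE -orbA => /or3P[] /eqP to.
    - by rewrite -(third y o) ?eqxx ?orbT // ?fd ?hd ?hy ?to // !inE eqxx ?orbT.
    - by rewrite -(third d o) ?eqxx ?orbT // ?hx ?hd ?to // !inE eqxx ?orbT.
    by rewrite -(third x o) ?eqxx ?orbT // ?hx ?hy ?to // !inE eqxx ?orbT.
  move/subset_leq_card/leq_trans; apply.
  by rewrite setUC cardsU1 cards2; case: (_ \notin _); case: (_ != _).
case: (small_cut Gcubic Gcyc cX); rewrite ?c3 // => cX'.
case: GnotK4 => v w nvw; apply: contraT => nadj.
have : [set u | adj v u] \subset [set~ v] :\ w.
  apply/subsetP=> u; rewrite !inE => vu; apply/andP; split.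
    by apply: contraNneq nadj => <-.
  by apply: contraTneq vu => ->; rewrite adj_irrefl.
move/subset_leq_card; rewrite Gcubic; have := cardsC X; have := cardsC [set v].
have := cardsD1 w [set~ v]; rewrite !inE eq_sym nvw cards1 c3.
move: cX'; move: #|~: X| #|G| #|[set~ v]| #|_ :\ w| => i j k l; lia.
Qed.

Definition face_adj (f g : {set dart G}) : bool :=
  [exists d, (face R d == f) && (face R (rev d) == g)].

(** The link of the vertex [f] of the dual triangulation: the faces around [f] in
    cyclic order, from an arbitrary starting dart. *)
Definition link (f : {set dart G}) : seq {set dart G} :=
  if [pick d | face R d == f] is Some d then
    [seq face R (rev x) | x <- traject (face_perm R) d #|porbit (face_perm R) d|]
  else [::].

Lemma face_adj_sym : symmetric face_adj.
Proof.
suff imp f g : face_adj f g -> face_adj g f by move=> f g; apply/idP/idP; apply: imp.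
case/existsP=> d /andP[df dg]; apply/existsP; exists (rev d).
by rewrite rev_involutive df dg.
Qed.

Lemma face_adj_irrefl : irreflexive face_adj.
Proof.
move=> f; apply/existsP=> -[d /andP[/eqP <-]].
by rewrite eq_sym (negbTE (face_rev_neq d)).
Qed.

Lemma mem_face d d' : (d' \in traject (face_perm R) d #|porbit (face_perm R) d|)
  = (face R d' == face R d).
Proof. by rewrite -porbit_traject /face eq_porbit_mem. Qed.

Lemma mem_link f g : (g \in link f) = face_adj f g.
Proof.
rewrite /link; case: pickP => [d /eqP df|N]; last first.
  by apply/esym/existsP=> -[d /andP[df _]]; have := N d; rewrite df.
apply/mapP/existsP=> [[x xf ->]|[x /andP[xf /eqP <-]]]; exists x => //.
  by move: xf; rewrite mem_face df => ->; rewrite eqxx.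
by rewrite mem_face df.
Qed.

Lemma link_inj d : {in traject (face_perm R) d #|porbit (face_perm R) d| &,
  injective (fun x => face R (rev x))}.
Proof.
move=> x y; rewrite !mem_face => /eqP xd /eqP yd.
by apply: face_pair_inj; rewrite xd yd.
Qed.

Lemma link_uniq f : uniq (link f).
Proof.
rewrite /link; case: pickP => // d _.
by rewrite map_inj_in_uniq ?uniq_traject_porbit //; apply: link_inj.
Qed.

(** The relation [e] is adjacency in [link_cycle]; in [next_link], it is the graph
    of the function to be compared with [next]. *)
Lemma cycle_link (e : rel {set dart G}) f :
  (forall x, face R x = f ->
     e (face R (rev x)) (face R (rev (face_perm R x)))) ->
  path.cycle e (link f).
Proof.
move=> step; rewrite /link; case: pickP => // d /eqP df.
have := card_porbit_neq0 (face_perm R) d.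
have := iter_porbit (face_perm R) d; case: #|_| => // n fn _ /=.
rewrite -(map_rcons (fun x => face R (rev x))).
have -> : rcons (traject (face_perm R) (face_perm R d) n) d =
          traject (face_perm R) (face_perm R d) n.+1.
  by rewrite trajectSr -iterSr fn.
elim: n.+1 d df {fn} => //= k IHk d df.
by rewrite step //= IHk // face_face_perm.
Qed.

Lemma link_cycle f : path.cycle face_adj (link f).
Proof.
apply: cycle_link => x _; rewrite face_adj_sym; apply/existsP.
exists (R (R (rev x))).
by rewrite -(face_rot R (face_perm R x)) face_permE -(face_rot R (R _)) rot3 !eqxx.
Qed.

Lemma next_link x : next (link (face R x)) (face R (rev x)) =
  face R (rev (face_perm R x)).
Proof.
pose E : rel {set dart G} := fun a b => [exists y, [&& face R y == face R x,
  face R (rev y) == a & face R (rev (face_perm R y)) == b]].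
have cE : path.cycle E (link (face R x)).
  by apply: cycle_link => y yx; apply/existsP; exists y; rewrite yx !eqxx.
have xl : face R (rev x) \in link (face R x).
  by rewrite mem_link; apply/existsP; exists x; rewrite !eqxx.
have /existsP[y /and3P[/eqP yx /eqP e1 /eqP <-]] := next_cycle cE xl.
by rewrite (face_pair_inj yx e1).
Qed.

(** By [three_faces], two adjacent neighbours of a face meet it at a vertex. *)
Lemma link_chordless f : chordless face_adj (link f).
Proof.
move=> a b; rewrite !mem_link.
case/existsP=> x /andP[/eqP <- /eqP <-].
case/existsP=> y /andP[/eqP yx /eqP <-].
case/existsP=> o /andP[/eqP ox /eqP oy].
have [] := @three_faces x o (rev y).
- by rewrite ox.
- by rewrite oy.
- by rewrite rev_involutive yx.
- by move=> xE; right; rewrite -yx next_link face_permE -xE.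
by rewrite rev_involutive => yE; left; rewrite next_link face_permE -yE.
Qed.

Lemma link_size f : link f != [::] -> 3 < size (link f).
Proof.
by rewrite /link; case: pickP => // d _ _; rewrite size_map size_traject face_size.
Qed.

Lemma exists_hole : exists c k, bipartite_cycle face_adj c k.
Proof.
have /card_gt0P[v _] := Gconn.1; have [w /dart_of[d _]] := cubic_deg v.
apply: (even_hole face_adj_sym face_adj_irrefl mem_link link_uniq link_cycle
         link_chordless link_size (f0 := face R d)).
have : face R (rev d) \in link (face R d).
  by rewrite mem_link; apply/existsP; exists d; rewrite !eqxx.
by case: (link _).
Qed.

End Rotation.
End Planar.

(** * Twisting along an even dual cycle *)

Lemma next_neq_prev (T : eqType) (c : seq T) x :
  uniq c -> 2 < size c -> x \in c -> next c x != prev c x.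
Proof.
move=> uc sc xc; have [i s E] := rot_to xc.
rewrite -(next_rot i) // -(prev_rot i) // E.
have := uc; rewrite -(rot_uniq i) E; have := sc; rewrite -(size_rot i) E.
case: s {E} => [|y [|z s]] // _ u.
have xn : x \notin [:: y, z & s] by case/andP: u.
have -> : next [:: x, y, z & s] x = y by rewrite /= eqxx.
have -> : prev [:: x, y, z & s] x = last z s.
  by rewrite prev_nth mem_head (memNindex xn) (nth_last x [:: x, y, z & s]).
apply: contraTneq u => ->.
by rewrite /= mem_last andbF.
Qed.

Section Twist.

Variables (G : sgraph) (R : rotation_system G) (X : {set G}).
Implicit Types (d o x y : dart G).

Local Notation rev := (dart_rev G).

Lemma tail_rotV d : tail ((rot R)^-1%g d) = tail d.
Proof. by rewrite -(tail_rot R) permKV. Qed.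

(** Inverting the rotation at the vertices in [X] is, up to orientation, the same
    as twisting the edges of the cut of [X]. *)
Definition twist_fun d := if tail d \in X then (rot R)^-1%g d else R d.

Lemma tail_twist_fun d : tail (twist_fun d) = tail d.
Proof. by rewrite /twist_fun; case: ifP; rewrite ?tail_rotV ?tail_rot. Qed.

Lemma twist_inj : injective twist_fun.
Proof.
move=> d d' e; have t : tail d = tail d' by rewrite -tail_twist_fun e tail_twist_fun.
by move: e; rewrite /twist_fun t; case: ifP => _; apply: perm_inj.
Qed.

Lemma twistP d d' : (d' \in porbit (perm twist_inj) d) = (tail d' == tail d).
Proof.
rewrite -(rotP R).
case tX : (tail d \in X).
  rewrite -(porbitV R); have E i : ((perm twist_inj) ^+ i)%g d = ((rot R)^-1 ^+ i)%g d
      /\ tail (((rot R)^-1 ^+ i)%g d) = tail d.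
    elim: i => [|i [IH1 IH2]]; first by rewrite !expg0 !perm1.
    by rewrite !expgSr !permM IH1 permE /twist_fun tail_rotV IH2 tX.
  by apply/porbitP/porbitP=> -[i ->]; exists i; rewrite (E i).1.
have E i : ((perm twist_inj) ^+ i)%g d = ((rot R) ^+ i)%g d
    /\ tail (((rot R) ^+ i)%g d) = tail d.
  elim: i => [|i [IH1 IH2]]; first by rewrite !expg0 !perm1.
  by rewrite !expgSr !permM IH1 permE /twist_fun tail_rot IH2 tX.
by apply/porbitP/porbitP=> -[i ->]; exists i; rewrite (E i).1.
Qed.

Definition twist : rotation_system G := RotationSystem twistP.

(** Outside of [X] the new faces follow the old ones; inside they follow them
    backwards ([twist_step_rev]).  At an edge of the cut they change sides. *)
Lemma twist_step d : head d \notin X -> face_perm twist d = face_perm R d.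
Proof. by move=> hd; rewrite !face_permE /= permE /twist_fun tail_rev (negbTE hd). Qed.

Lemma twist_step_rev d : head d \in X ->
  face_perm twist (rev (face_perm R d)) = rev d.
Proof.
move=> hd; rewrite [LHS]face_permE rev_involutive /= permE /twist_fun.
by rewrite tail_face_perm hd face_permE permK.
Qed.

(** The old face that the new face of [d] runs along when it leaves the tail of
    [d]. *)
Definition side d := if tail d \in X then face R (rev d) else face R d.

Lemma side_face_perm d :
  side (face_perm twist d) = if head d \in X then face R (rev d) else face R d.
Proof.
rewrite /side tail_face_perm; case: ifP => hX; last first.
  by rewrite twist_step ?hX // face_face_perm.
rewrite face_permE /= permE /twist_fun tail_rev hX -(face_rot R).
by rewrite permKV.
Qed.

Hypothesis Gcubic : cubic G.

Lemma side_adj d d' : tail d = tail d' -> d != d' ->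
  face_adj R (side d) (side d').
Proof.
move=> t n; rewrite /side -t.
have [o [e1 e2]] : exists o, face R o =
   (if tail d \in X then face R (rev d) else face R d) /\ face R (rev o) =
   (if tail d \in X then face R (rev d') else face R d').
  case: ifP => _; last exact: adj_face.
  rewrite -!face_rot; apply: adj_face => //; first by rewrite !tail_rot.
  by rewrite (inj_eq (@perm_inj _ R)).
by apply/existsP; exists o; rewrite e1 e2 !eqxx.
Qed.

End Twist.

Section TwistHole.

Variables (G : sgraph) (R : rotation_system G).
Hypotheses (Gconn : connected G) (Gcubic : cubic G).
Hypothesis Gcyc : cyclically_edge_connected 4 G.
Hypothesis Rplanar : embeds_in_genus R 0.
Variables (c : seq {set dart G}) (k : {set dart G} -> bool).
Hypothesis hole : bipartite_cycle (face_adj R) c k.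
Implicit Types (d o x y : dart G).

Local Notation rev := (dart_rev G).

(** The edges crossed by the dual cycle [c]. *)
Definition twisted d : bool := (face R d \in c) &&
  ((face R (rev d) == next c (face R d)) || (face R (rev d) == prev c (face R d))).

Let c_uniq : uniq c. Proof. by case: hole => /and3P[]. Qed.
Let c_cycle : path.cycle (face_adj R) c. Proof. by case: hole => /and3P[]. Qed.
Let c_size : 2 < size c. Proof. by case: hole => /and3P[]. Qed.

Let pair_inj := face_pair_inj Gconn Gcubic Gcyc Rplanar.

Lemma twisted_rev d : twisted (rev d) = twisted d.
Proof.
suff imp o : twisted o -> twisted (rev o).
  by apply/idP/idP=> /imp; rewrite ?rev_involutive.
rewrite /twisted rev_involutive => /andP[oc /orP[] /eqP ->].
  by rewrite mem_next oc prev_next // eqxx orbT.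
by rewrite mem_prev oc next_prev // eqxx.
Qed.

(** The cycle enters and leaves each of its faces once. *)
Lemma twisted_pair f : f \in c -> exists d1 d2, d1 != d2 /\
  forall d, twisted d && (face R d == f) = (d == d1) || (d == d2).
Proof.
move=> fc; have /existsP[d1 /andP[/eqP f1 /eqP n1]] := next_cycle c_cycle fc.
have := prev_cycle c_cycle fc; rewrite face_adj_sym.
case/existsP=> d2 /andP[/eqP f2 /eqP n2]; exists d1, d2; split.
  apply: contraTneq (next_neq_prev c_uniq c_size fc) => E.
  by rewrite -n1 -n2 E eqxx.
move=> d; rewrite /twisted; apply/andP/orP=> [[/andP[_ +] /eqP fd]|].
  by rewrite fd => /orP[] /eqP n; [left|right]; apply/eqP/pair_inj;
     rewrite ?fd ?n.
by case=> /eqP ->; rewrite ?f1 ?f2 ?n1 ?n2 fc !eqxx ?orbT.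
Qed.

Lemma twisted_even d0 : ~~ odd #|[set d | twisted d && (face R d == face R d0)]|.
Proof.
case: (boolP (face R d0 \in c)) => [/twisted_pair[d1 [d2 [n E]]]|nc].
  rewrite (_ : [set d | _] = [set d1; d2]) ?cards2 ?n //.
  by apply/setP=> d; rewrite !inE E.
rewrite (_ : [set d | _] = set0) ?cards0 //; apply/setP=> d; rewrite !inE.
by apply/negbTE/negP=> /andP[/andP[dc _] /eqP e]; rewrite -e dc in nc.
Qed.

Variable X : {set G}.
Hypothesis twistedX : forall d, twisted d = (tail d \in X) (+) (head d \in X).

Let R' := twist R X.

(** The cut divides the boundary of each face of [c] into a part inside [X] and a
    part outside.  The new faces along [c] alternate between inner parts of one
    colour and outer parts of the other colour, and the label of a dart records
    which.  Two faces at a vertex are adjacent, so if both lie on [c] then their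
    colours differ. *)
Lemma twist_strong : strong R'.
Proof.
pose lab d : {set dart G} + bool :=
  let f := side R X d in
  if f \in c then inr (k f (+) (tail d \in X)) else inl f.
apply: (strong_of_labels Gcubic (lab := lab)).
  move=> d; rewrite /lab side_face_perm tail_face_perm /side.
  have adj_d : face_adj R (face R d) (face R (rev d)).
    by apply/existsP; exists d; rewrite !eqxx.
  have flip : twisted d -> [/\ face R d \in c, face R (rev d) \in c &
                               k (face R d) = ~~ k (face R (rev d))].
    move=> tw; have fc : face R d \in c by case/andP: tw.
    have rc : face R (rev d) \in c by move: tw; rewrite -twisted_rev => /andP[].
    by split=> //; have := hole.2 _ _ fc rc adj_d; do 2!case: (k _).
  move: flip; rewrite twistedX.
  case: (tail d \in X); case: (head d \in X) => //= /(_ isT)[-> -> ->].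
  - by rewrite addbF addbT.
  - by rewrite addbF addbT.
move=> d d' t n; have adj_s := side_adj R X Gcubic t n.
rewrite /lab -t; case: ifP => sc; case: ifP => sc' //.
  have := hole.2 _ _ sc sc' adj_s.
  by apply: contra => /eqP[] /addIb ->.
apply/eqP=> -[E]; move: adj_s.
by rewrite E face_adj_irrefl.
Qed.

(** From [d], follow its old face up to the next twisted edge: the part of the
    boundary in between belongs to a single new face, in one direction or the
    other. *)
Lemma twisted_walk n d : twisted (iter n.+1 (face_perm R) d) -> exists b,
  [/\ twisted b, face R b = face R d, (tail b \in X) = (head d \in X) &
    if head d \in X then face R' (rev b) = face R' (rev d)
    else face R' b = face R' d].
Proof.
have step o : if head o \in X
    then face R' (rev (face_perm R o)) = face R' (rev o)
    else face R' (face_perm R o) = face R' o.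
  case: ifP => hX; first by rewrite -(face_face_perm R') twist_step_rev.
  by rewrite -(@twist_step _ R X) ?hX // face_face_perm.
have here d' : twisted (face_perm R d') -> exists b,
    [/\ twisted b, face R b = face R d', (tail b \in X) = (head d' \in X) &
      if head d' \in X then face R' (rev b) = face R' (rev d')
      else face R' b = face R' d'].
  move=> tw; exists (face_perm R d'); split=> //.
  - exact: face_face_perm.
  - by rewrite tail_face_perm.
  exact: step.
elim: n d => [|n IHn] d tw; first exact: here.
case tw1 : (twisted (face_perm R d)); first exact: here.
have [|b [tb fb hb rb]] := IHn (face_perm R d); first by rewrite -iterSr.
have hh : (head (face_perm R d) \in X) = (head d \in X).
  move: tw1; rewrite twistedX tail_face_perm.
  by case: (head d \in X); case: (head _ \in X).
exists b; split=> //; rewrite ?fb ?face_face_perm ?hb ?hh //.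
by move: rb (step d); rewrite hh; case: ifP => _ -> ->.
Qed.

(** An old face on [c] has two twisted edges.  The new face along the inner part
    of its boundary and the new face along the outer part both contain both of
    these edges, while two faces of a planar embedding share at most one. *)
Lemma twist_nonplanar : ~ embeds_in_genus R' 0.
Proof.
move=> R'planar.
have [f fc] : exists f, f \in c.
  by case: (c) c_size => // f s _; exists f; rewrite mem_head.
have [d [d2 [n E]]] := twisted_pair fc.
have [td /eqP fd] : twisted d /\ face R d == f by apply/andP; rewrite E eqxx.
have walk o : twisted o -> exists b,
  [/\ twisted b, face R b = face R o, (tail b \in X) = (head o \in X) &
    if head o \in X then face R' (rev b) = face R' (rev o)
    else face R' b = face R' o].
  move=> to; apply: (@twisted_walk #|porbit (face_perm R) o|.-1).
  by rewrite prednK ?iter_porbit // lt0n card_porbit_neq0.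
(* One walk goes along one part of the boundary, the next walk along the other
   part and back to [d]. *)
have [b [tb fb hb rb]] := walk d td.
have [b' [tb' fb' hb' rb']] := walk b tb.
have hbd : (head b \in X) = ~~ (head d \in X).
  by move: tb; rewrite twistedX hb; case: (head d \in X); case: (head b \in X).
have nbd : b != d.
  apply: contraTneq td => e; move: hb; rewrite e twistedX => ->.
  by rewrite addbb.
have nbb : b' != b.
  by apply: contraTneq tb => e; move: hb'; rewrite e twistedX => ->; rewrite addbb.
have b'd : b' = d.
  have := E b; have := E b'; rewrite tb tb' fb' fb fd eqxx (negbTE nbd) /=.
  move=> /esym/orP[/eqP //|/eqP e] /esym/eqP e'.
  by rewrite e e' eqxx in nbb.
have eqs : face R' b = face R' d /\ face R' (rev b) = face R' (rev d).
  by move: rb rb'; rewrite hbd b'd; case: (head d \in X) => /= -> ->.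
move: nbd; rewrite (face_pair_inj Gconn Gcubic Gcyc R'planar eqs.1 eqs.2).
by rewrite eqxx.
Qed.

End TwistHole.

Theorem theorem3p5 (G : sgraph) (Gconn : connected G) (Gcubic : cubic G)
    (Gplanar : planar G) (Gcyc : cyclically_edge_connected 4 G)
    (GnotK4 : ~ complete G) :
  exists R : rotation_system G,
    strong R /\ exists2 g : nat, 0 < g & embeds_in_genus R g.
Proof.
have [R Rplanar] := Gplanar.
have [c [k hole]] := exists_hole Gconn Gcubic Gcyc Rplanar GnotK4.
have [X twX] := planar_cut Gconn (cubic_deg Gcubic) Rplanar
  (twisted_rev hole) (twisted_even Gconn Gcubic Gcyc Rplanar hole).
exists (twist R X); split.
  exact: (twist_strong Gconn Gcubic Gcyc Rplanar hole twX).
apply: (positive_genus Gconn (cubic_deg Gcubic)).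
exact: (twist_nonplanar Gconn Gcubic Gcyc Rplanar hole twX).
Qed.
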